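(* Let $H$ be a stable $n$-th order LTI model in diagonal canonical form $H(s)=D+\sum_{i=1}^n \frac{\Phi_i}{s-\lambda_i}$ and let $0<r<n$. For $\alpha\in\{0,1\}^n$ and $D_\alpha\in\mathbb{R}^{n_y\times n_u}$ let $H_\alpha(s)=D_\alpha+\sum_{i=1}^n\alpha_i\frac{\Phi_i}{s-\lambda_i}$. Consider the $r$-th order optimal $\mathcal{H}_2$ modal truncation problem $$\min_{\alpha,D_\alpha}\ \Vert H-H_\alpha\Vert_2\quad\text{s.t.}\quad \alpha\in\{0,1\}^n,\ D_\alpha\in\mathbb{R}^{n_y\times n_u},\ \mathds{1}^T\alpha=r,\ M\alpha=0 .$$ Then its solution $H_{\alpha}^\star$ is such that $D_\alpha^\star=D$ and $\alpha^\star$ is a solution of the problem $$\min_{\alpha}\ (\mathds{1}-\alpha)^TQ(\mathds{1}-\alpha)\quad\text{s.t.}\quad \alpha\in\{0,1\}^n,\ \mathds{1}^T\alpha=r,\ M\alpha=0,$$ where $Q\in\mathbb{C}^{n\times n}$ is the Hermitian matrix with entries $$[Q]_{i,j}=\frac{\mathrm{tr}(\Phi_i\Phi_j^H)}{-\lambda_i-\lambda_j^*},\qquad i,j=1,\ldots,n,$$ and the latter problem is a convex quadratic binary problem.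
   Context: Setting. $H$ is the LTI model $\dot x=Ax+Bu$, $y=Cx+Du$ with real matrices $A\in\mathbb{R}^{n\times n}$, $B\in\mathbb{R}^{n\times n_u}$, $C\in\mathbb{R}^{n_y\times n}$, $D\in\mathbb{R}^{n_y\times n_u}$, identified with its transfer function $H(s)=C(sI-A)^{-1}B+D$. It is stable (all eigenvalues of $A$ have negative real part) and $A$ has semi-simple eigenvalues $\lambda_1,\dots,\lambda_n$ (listed with multiplicity). With $AX=X\Delta$, $\Delta=\mathrm{diag}(\lambda_1,\dots,\lambda_n)$, $X$ invertible, $B_\Delta=X^{-1}B$, $C_\Delta=CX$, the residues are $\Phi_i=C_\Delta e_ie_i^TB_\Delta\in\mathbb{C}^{n_y\times n_u}$, which gives the diagonal canonical form. Conjugate pairs. The eigenvectors are chosen so that the non-real poles are grouped into $n_c$ disjoint pairs of indices $\{i,j\}$ with $\mathrm{Im}(\lambda_i)>0$, $\lambda_j=\lambda_i^*$ and $\Phi_j=\Phi_i^*$, and so that $\Phi_i$ is real when $\lambda_i$ is real. $\mathcal{I}^C$ is the set of these pairs. $M\in\mathbb{R}^{n_c\times n}$ has one row per pair $\{i,j\}\in\mathcal{I}^C$, with entry $1$ in column $i$, $-1$ in column $j$ and $0$ elsewhere; thus $M\alpha=0$ means $\alpha_i=\alpha_j$ for every pair. Notation. $\mathds{1}\in\mathbb{R}^n$ is the all-ones vector; $^*$ is (entrywise) complex conjugation, $^T$ transpose, $^H$ conjugate transpose, $\Vert\cdot\Vert_F$ the Frobenius norm. Norm. For a stable strictly proper $G$,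 $\Vert G\Vert_2=\sqrt{\frac1{2\pi}\int_{-\infty}^{\infty}\Vert G(\imath\nu)\Vert_F^2\,d\nu}$; it is $+\infty$ for a stable $G$ that is not strictly proper. ''Convex quadratic binary problem'' means: binary variables, affine constraints, and a quadratic objective that is convex in the continuous relaxation. *)

(* Defs.v *)
(* MathComp-Analysis: the reals are an arbitrary R : realType and the complex
   numbers are R[i]. *)
From mathcomp Require Import all_boot all_order all_algebra.
From mathcomp Require Import complex.
From mathcomp Require Import all_classical all_reals all_analysis.

Set Implicit Arguments.
Unset Strict Implicit.
Unset Printing Implicit Defensive.

Import Order.TTheory GRing.Theory Num.Theory.
Import numFieldNormedType.Exports.

Local Open Scope classical_set_scope.
Local Open Scope sesquilinear_scope.
Local Open Scope complex_scope.
Local Open Scope ring_scope.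

Notation toC := (map_mx (fun x => x%:C)).

Section LTI.
Variables (R : realType) (n nu ny : nat).

Definition stable (A : 'M[R]_n) : Prop :=
  forall z : R[i], eigenvalue (toC A) z -> complex.Re z < 0.

(* Only meaningful when s is not an eigenvalue of A: invmx returns its argument
   on singular matrices. *)
Definition transfer (A : 'M[R]_n) (B : 'M[R]_(n, nu)) (C : 'M[R]_(ny, n))
    (D : 'M[R]_(ny, nu)) (s : R[i]) : 'M[R[i]]_(ny, nu) :=
  toC C *m invmx (s%:M - toC A) *m toC B + toC D.

Definition residue (B : 'M[R]_(n, nu)) (C : 'M[R]_(ny, n)) (X : 'M[R[i]]_n)
    (i : 'I_n) : 'M[R[i]]_(ny, nu) :=
  (toC C *m X) *m delta_mx i (0 : 'I_1) *m delta_mx (0 : 'I_1) i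
    *m (invmx X *m toC B).

Definition modal_model (lam : 'I_n -> R[i]) (Phi : 'I_n -> 'M[R[i]]_(ny, nu))
    (a : 'cV[R]_n) (Da : 'M[R]_(ny, nu)) (s : R[i]) : 'M[R[i]]_(ny, nu) :=
  toC Da + \sum_i ((a i 0)%:C / (s - lam i)) *: Phi i.

(* A pair {i, j} with Im (lam i) > 0 is stored as the ordered pair (i, j). *)
Definition conjugate_pairing (lam : 'I_n -> R[i])
    (Phi : 'I_n -> 'M[R[i]]_(ny, nu)) (IC : {set 'I_n * 'I_n}) : Prop :=
  [/\ forall p, p \in IC ->
        [/\ 0 < complex.Im (lam p.1), lam p.2 = (lam p.1)^*
          & Phi p.2 = map_mx Num.conj (Phi p.1)],
      forall p q, p \in IC -> q \in IC -> p != q ->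
        ([set p.1; p.2] :&: [set q.1; q.2] = finset.set0)%SET,
      forall i, complex.Im (lam i) != 0 ->
        exists2 p, p \in IC & i \in [set p.1; p.2]%SET
    & forall i, complex.Im (lam i) = 0 -> Phi i \is a realmx].

Definition pairing_mx (IC : {set 'I_n * 'I_n}) : 'M[R]_(#|IC|, n) :=
  \matrix_(k, l) ((l == (enum_val k).1)%:R - (l == (enum_val k).2)%:R).

Definition Qmx (lam : 'I_n -> R[i]) (Phi : 'I_n -> 'M[R[i]]_(ny, nu)) :
    'M[R[i]]_n :=
  \matrix_(i, j) (\tr (Phi i *m (Phi j)^t*) / (- lam i - (lam j)^*)).

End LTI.

Section H2norm.
Variables (R : realType) (nu ny : nat).

Definition frobenius_norm (M : 'M[R[i]]_(ny, nu)) : R :=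
  Num.sqrt (\sum_i \sum_j Normc.normc (M i j) ^+ 2).

(* Every entry is a rational function whose numerator has smaller degree than
   its denominator; G is only constrained off the zeros of the denominators,
   where its values carry no meaning. *)
Definition strictly_proper (G : R[i] -> 'M[R[i]]_(ny, nu)) : Prop :=
  forall i j, exists p q : {poly R[i]},
    (size p < size q)%N /\
    (forall s, q.[s] != 0 -> G s i j = p.[s] / q.[s]).

(* Meant for stable rational G. *)
Definition h2_norm (G : R[i] -> 'M[R[i]]_(ny, nu)) : \bar R :=
  if `[< strictly_proper G >] then
    sqrte (((2 * pi)^-1)%:E *
           \int[lebesgue_measure]_(w in [set: R])
             (frobenius_norm (G (0 +i* w)) ^+ 2)%:E)%E
  else +oo%E.

End H2norm.

Section Optimization.

(* For a complex-valued objective the order is that of R[i], in which x <= y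
   forces x and y to have the same imaginary part. *)
Definition minimizer (disp : Order.disp_t) (V : porderType disp) (T : Type)
    (S : set T) (f : T -> V) (x : T) : Prop :=
  S x /\ forall y, S y -> (f x <= f y)%O.

Variables (R : realType) (n : nat).

Definition binary (a : 'cV[R]_n) : Prop := forall i, a i 0 = 0 \/ a i 0 = 1.

Definition truncation_feasible (r : nat) (m : nat) (M : 'M[R]_(m, n)) :
    set 'cV[R]_n :=
  [set a | [/\ binary a, (const_mx 1 : 'cV[R]_n)^T *m a = (r%:R)%:M
             & M *m a = 0]].

Definition truncation_objective (Q : 'M[R[i]]_n) (a : 'cV[R]_n) : R[i] :=
  ((toC (const_mx 1 - a))^T *m Q *m toC (const_mx 1 - a)) 0 0.

Definition unit_box : set 'cV[R]_n := [set a | forall i, 0 <= a i 0 <= 1].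

(* The objective is given by a complex expression: it must be real-valued on
   real vectors, and a quadratic polynomial with real coefficients there. *)
Definition convex_quadratic_binary (S : set 'cV[R]_n) (f : 'cV[R]_n -> R[i]) :
    Prop :=
  [/\ exists m1 m2 (E1 : 'M[R]_(m1, n)) (b1 : 'cV[R]_m1)
             (E2 : 'M[R]_(m2, n)) (b2 : 'cV[R]_m2),
        S = [set a | [/\ binary a, E1 *m a = b1
                       & forall k, (E2 *m a) k 0 <= b2 k 0]],
      exists (P : 'M[R]_n) (q : 'cV[R]_n) (c : R),
        forall a, f a = ((a^T *m P *m a + q^T *m a) 0 0 + c)%:C
    & convex_function unit_box (fun a => complex.Re (f a))].

End Optimization.

(* Main.v *)
(* By partial fractions, for s = i w on the imaginary axis,
     1 / ((s - l_i) (s - l_j)^* )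
       = (1 / (s - l_i) + 1 / (s - l_j)^* ) / (- l_i - l_j^* ),
   so the squared Frobenius norm of sum_i b_i Phi_i / (s - l_i), with b real, is
   2 Re sum_i c_i / (s - l_i), where c_i is the i-th row sum in b^T Q b. An
   antiderivative in w combines arctangents, weighted by Re c_i, and logarithms,
   weighted by Im c_i. As Q is Hermitian the Im c_i sum to 0, so the logarithms
   cancel at infinity and the arctangents contribute 2 pi Re (b^T Q b). Hence
   the squared H2 norm is b^T Q b, which is therefore nonnegative for every real
   b: this gives convexity. Finiteness of the optimal error forces D_alpha = D. *)
Require Import Defs.
From mathcomp Require Import all_boot all_order all_algebra.
From mathcomp Require Import complex.
From mathcomp Require Import all_classical all_reals all_analysis.
From mathcomp Require Import measurable_realfun ring zify.

Set Implicit Arguments.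
Unset Strict Implicit.
Unset Printing Implicit Defensive.

Import Order.TTheory GRing.Theory Num.Theory.
Import numFieldNormedType.Exports.

Local Open Scope classical_set_scope.
Local Open Scope complex_scope.
Local Open Scope ring_scope.

(** * Integration of partial fractions over the real line *)

Section Integration.
Variable R : realType.
Implicit Types f F : R -> R.

(** The line is cut at 0 and the negative half is reflected by [x -> - x], where [- F (- x)] serves
    as antiderivative; the two boundary values at 0 cancel. *)
Lemma ge0_continuous_FTC2T f F (lN lP : R) :
  (forall x, 0 <= f x) -> continuous f ->
  (forall x : R, is_derive x (1 : R) F (f x)) ->
  F x @[x --> -oo] --> lN -> F x @[x --> +oo] --> lP ->
  (\int[lebesgue_measure]_x (f x)%:E = (lP - lN)%:E)%E.
Proof.
move=> f0 cf dF FN FP.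
have half (g G : R -> R) (l : R) : (forall x, 0 <= g x) -> continuous g ->
    (forall x : R, is_derive x (1 : R) G (g x)) -> G x @[x --> +oo] --> l ->
    (\int[lebesgue_measure]_(x in `[0%R, +oo[) (g x)%:E = (l - G 0)%:E)%E.
  move=> g0 cg dG Gl; rewrite EFinB.
  apply: ge0_continuous_FTC2y => //.
  - exact: continuous_subspaceT.
  - apply: cvg_at_right_filter.
    by apply/differentiable_continuous/derivable1_diffP; case: (dG 0).
  - by move=> x _; rewrite derive1E; apply: (@derive_val _ _ _ _ _ _ _ (dG x)).
have mf : measurable_fun [set: R] f by exact: continuous_measurable_fun.
have mpos : measurable (`[0%R, +oo[%classic : set R) by [].
rewrite -(setUv (`[0%R, +oo[%classic : set R)).
rewrite ge0_integral_setU//=; last 4 first.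
- exact: measurableC.
- by apply/measurable_EFinP; rewrite setUv.
- by move=> x _; rewrite lee_fin.
- exact/disj_setPCl.
rewrite setCitvr integral_itv_bndo_bndc; last first.
  exact/measurable_EFinP/measurable_funTS.
rewrite -{2}oppr0 ge0_integration_by_substitutionNy//; last first.
  exact: continuous_subspaceT.
have cfN : continuous (f \o -%R).
  move=> x; apply: (@continuous_comp _ _ _ -%R f); last exact: cf.
  exact: opp_continuous.
have dFN (x : R) : is_derive x (1 : R) (fun x => - F (- x)) ((f \o -%R) x).
  have dFx := dF (- x).
  have -> : (f \o -%R) x = - (f (- x) * -1) by rewrite /= mulrN1 opprK.
  apply: is_deriveN; exact: is_derive1_comp.
have FNN : - F (- x) @[x --> +oo] --> - lN by apply: cvgN; apply/cvgNy_compNP.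
have f0N x : 0 <= (f \o -%R) x by exact: f0.
rewrite (half f F lP f0 cf dF FP) (half _ _ _ f0N cfN dFN FNN).
by rewrite -EFinD oppr0; congr EFin; ring.
Qed.

(** With [c = u + i v] and [l = - s + i t], this is an antiderivative in [w] of the sum of the real
    parts of [c / (i w - l)]. *)
Definition arclog n (u s t v : 'I_n -> R) w :=
  \sum_i (u i * atan ((w - t i) / s i) +
          v i / 2 * ln (s i ^+ 2 + (w - t i) ^+ 2)).

Lemma is_derive_arclog n (u s t v : 'I_n -> R) w : (forall i, 0 < s i) ->
  is_derive w (1 : R) (arclog u s t v)
    (\sum_i (u i * s i + v i * (w - t i)) / (s i ^+ 2 + (w - t i) ^+ 2)).
Proof.
move=> s0.
have -> : arclog u s t v =
  \sum_i (fun w => u i * atan ((w - t i) / s i) +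
          v i / 2 * ln (s i ^+ 2 + (w - t i) ^+ 2)).
  by apply/funext => x; rewrite fct_sumE.
suff dh i : is_derive w (1 : R) (fun w => u i * atan ((w - t i) / s i) +
    v i / 2 * ln (s i ^+ 2 + (w - t i) ^+ 2))
    ((u i * s i + v i * (w - t i)) / (s i ^+ 2 + (w - t i) ^+ 2)).
  by apply: is_derive_sum.
have d0 : 0 < s i ^+ 2 + (w - t i) ^+ 2.
  by rewrite ltr_pwDl ?sqr_ge0// exprn_gt0.
have da : is_derive w (1 : R) (fun w => atan ((w - t i) / s i))
    ((1 + ((w - t i) / s i) ^+ 2)^-1 * (s i)^-1).
  apply: (@is_derive1_comp _ atan (fun w => (w - t i) / s i)).
  apply: is_derive_eq; rewrite /GRing.scale/= /cst/=; ring.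
have dl : is_derive w (1 : R) (fun w => ln (s i ^+ 2 + (w - t i) ^+ 2))
    ((s i ^+ 2 + (w - t i) ^+ 2)^-1 * (2 * (w - t i))).
  apply: (@is_derive1_comp _ (@ln R) (fun w => s i ^+ 2 + (w - t i) ^+ 2)).
    exact: is_derive1_ln.
  apply: is_derive_eq; rewrite /GRing.scale/= /cst/=; ring.
have d := is_deriveD (is_deriveZ (u i) da) (is_deriveZ (v i / 2) dl).
apply: (@is_derive_eq _ _ _ _ _ _ _ _ d).
rewrite /GRing.scale/=.
field.
by rewrite !gt_eqF.
Qed.

(** Each logarithmic term grows like [v i * ln w], and the condition on [v] cancels this growth in
    the sum. What is left of the logarithms is a function of [w^-1], continuous and zero at 0. *)
Lemma cvg_arclogy n (u s t v : 'I_n -> R) : (forall i, 0 < s i) ->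
  \sum_i v i = 0 ->
  arclog u s t v w @[w --> +oo] --> (\sum_i u i) * (pi / 2).
Proof.
move=> s0 v0.
(* [s ^+ 2 + (w - t) ^+ 2 = w ^+ 2 * ((s / w) ^+ 2 + (1 - t / w) ^+ 2)] *)
pose g i (x : R) := ln ((s i * x) ^+ 2 + (1 - t i * x) ^+ 2).
have E : \forall w \near +oo, arclog u s t v w =
  \sum_i (u i * atan ((w - t i) / s i) + v i / 2 * g i w^-1).
  near=> w.
  have w0 : 0 < w by near: w; exact: nbhs_pinfty_gt.
  apply/eqP; rewrite -subr_eq0 /arclog -sumrB.
  suff diff i : u i * atan ((w - t i) / s i) +
        v i / 2 * ln (s i ^+ 2 + (w - t i) ^+ 2) -
      (u i * atan ((w - t i) / s i) + v i / 2 * g i w^-1) =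
      v i * (ln (w ^+ 2) / 2).
    by rewrite (eq_bigr _ (fun i _ => diff i)) -mulr_suml v0 mul0r.
  have -> : s i ^+ 2 + (w - t i) ^+ 2 =
      w ^+ 2 * ((s i * w^-1) ^+ 2 + (1 - t i * w^-1) ^+ 2).
    by field; rewrite gt_eqF.
  rewrite lnM ?posrE ?exprn_gt0//; last first.
    by rewrite ltr_pwDl ?sqr_ge0// exprn_gt0// mulr_gt0 ?invr_gt0.
  by rewrite -/(g i w^-1); field.
apply: cvg_trans; first by apply: near_eq_cvg; apply: filterS E => w ->.
rewrite mulr_suml; apply: (cvg_big (@add_continuous R^o)) => i _.
rewrite -[X in _ --> X]addr0; apply: cvgD.
  apply: cvgMl_tmp.
  have : ((w - t i) / s i) @[w --> +oo] --> +oo.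
    apply/cvgryPge => A; near=> w.
    rewrite ler_pdivlMr// lerBrDr; near: w.
    by apply: nbhs_pinfty_ge; exact: num_real.
  by move=> /cvg_comp; apply; exact: cvgy_atan.
rewrite -[X in _ --> X](mulr0 (v i / 2)); apply: cvgMl_tmp.
have g0 : g i 0 = 0 by rewrite /g !mulr0 subr0 expr0n expr1n add0r ln1.
have cg : {for 0, continuous (g i)}.
  apply: (@continuous_comp _ _ _ _ (@ln R)); last first.
    by apply: continuous_ln; rewrite !mulr0 subr0 expr0n expr1n add0r.
  apply: differentiable_continuous.
  by apply/derivable1_diffP.
rewrite -[X in _ --> X]g0.
have : w^-1 @[w --> +oo] --> (0 : R).
  apply/gtr0_cvgV0; first exact: nbhs_pinfty_gt.
  exact: cvg_id.
by move=> /cvg_comp; apply; exact: cg.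
Unshelve. all: by end_near.
Qed.

(** Turns the limit at [-oo] into one at [+oo]: the arctangent is odd, while the logarithm only has
    its centre reflected. *)
Lemma arclogN n (u s t v : 'I_n -> R) w :
  arclog u s t v (- w) = arclog (\- u) s (\- t) v w.
Proof.
apply: eq_bigr => i _ /=; congr (_ + _ * ln (_ + _)); last by ring.
by rewrite -opprD mulNr atanN mulrN mulNr opprK.
Qed.

(** The limits of [arclog] at both ends are opposite. Nonnegativity is asked of the whole sum: a
    single term with [v i] nonzero decays only like [1 / w] and is not integrable. *)
Lemma integral_partial_fractions n (u s t v : 'I_n -> R)
    (f := fun w => \sum_i (u i * s i + v i * (w - t i)) /
                          (s i ^+ 2 + (w - t i) ^+ 2)) :
  (forall i, 0 < s i) -> \sum_i v i = 0 -> (forall w, 0 <= f w) ->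
  (\int[lebesgue_measure]_w (f w)%:E = (pi * \sum_i u i)%:E)%E.
Proof.
move=> s0 v0 f0.
have cf : continuous f.
  move=> w; apply: (cvg_big (@add_continuous R^o)) => i _.
  have d0 : 0 < s i ^+ 2 + (w - t i) ^+ 2.
    by rewrite ltr_pwDl ?sqr_ge0// exprn_gt0.
  have cn : {for w, continuous (fun w => u i * s i + v i * (w - t i))}.
    by apply: differentiable_continuous; apply/derivable1_diffP.
  have cd : {for w, continuous (fun w => s i ^+ 2 + (w - t i) ^+ 2)}.
    by apply: differentiable_continuous; apply/derivable1_diffP.
  by apply: cvgM; [exact: cn | apply: cvgV; [rewrite gt_eqF | exact: cd]].
have FN : arclog u s t v w @[w --> -oo] --> - ((\sum_i u i) * (pi / 2)).
  apply/cvgNy_compNP.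
  have -> : arclog u s t v \o -%R = arclog (\- u) s (\- t) v.
    by apply/funext => w; exact: arclogN.
  by rewrite -mulNr -sumrN; exact: cvg_arclogy.
have dF w := @is_derive_arclog n u s t v w s0.
rewrite (ge0_continuous_FTC2T f0 cf dF FN (@cvg_arclogy n u s t v s0 v0)).
by congr EFin; field.
Qed.

End Integration.

(** * Eigenvalues and resolvent of a diagonalized matrix *)

Section Diagonalization.
Variables (F : fieldType) (n : nat) (A X : 'M[F]_n) (lam : 'I_n -> F).
Hypotheses (Xu : X \in unitmx) (AX : A *m X = X *m diag_mx (\row_i lam i)).

Lemma diagonalization_eigenvalue i : eigenvalue A (lam i).
Proof.
(* [eigenvalue] refers to row eigenvectors, so the witness comes from the rows of the inverse of [X]
   and not from the columns of [X]. *)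
apply/eigenvalueP; exists (row i (invmx X)).
  rewrite -row_mul; have -> : invmx X *m A = diag_mx (\row_i lam i) *m invmx X.
    by rewrite -[A](mulmxK Xu) AX !mulmxA mulVmx// mul1mx.
  by apply/rowP => j; rewrite mul_diag_mx !mxE.
apply/eqP => r0; have := oner_neq0 F.
have := mulVmx Xu => /(congr1 (row i)); rewrite row_mul r0 mul0mx.
by move=> /rowP/(_ i); rewrite !mxE eqxx => ->; rewrite eqxx.
Qed.

Lemma resolvent_diag s : (forall i, s != lam i) ->
  invmx (s%:M - A) = X *m diag_mx (\row_i (s - lam i)^-1) *m invmx X.
Proof.
move=> sl; set V := X *m _ *m _.
have sA : s%:M - A = X *m diag_mx (\row_i (s - lam i)) *m invmx X.
  rewrite -[A](mulmxK Xu) AX; have -> : s%:M = X *m s%:M *m invmx X.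
    by rewrite scalar_mxC mulmxK.
  rewrite -mulmxBl -mulmxBr; congr (_ *m _ *m _).
  by apply/matrixP => i j; rewrite !mxE -mulrnBl.
have VK : (s%:M - A) *m V = 1%:M.
  rewrite sA /V !mulmxA mulmxKV// -[X *m _ *m _]mulmxA mulmx_diag.
  have -> : diag_mx (\row_i ((\row_j (s - lam j)) 0 i *
      (\row_j (s - lam j)^-1) 0 i)) = 1%:M :> 'M[F]_n.
    by apply/matrixP => i j; rewrite !mxE divff// subr_eq0.
  by rewrite mulmx1 mulmxV.
(* The right inverse [V] shows that [s%:M - A] is a unit, so that [invmx] is its genuine inverse. *)
have /mulmx1_unit[u _] := VK.
by rewrite -[LHS]mulmx1 -VK mulKmx.
Qed.

End Diagonalization.

(** * Residue expansion of the transfer function *)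

Section ModalForm.
Local Open Scope sesquilinear_scope.
Local Open Scope complex_scope.
Local Open Scope ring_scope.
Variables (R : realType) (n nu ny : nat).

(** The diagonal resolvent splits into multiples of [e_i e_i^T], and each of them produces one
    residue. Hence [H] is the modal model that keeps every pole. *)
Lemma transfer_modal (A : 'M[R]_n) (B : 'M[R]_(n, nu)) (C : 'M[R]_(ny, n))
    (D : 'M[R]_(ny, nu)) (X : 'M[R[i]]_n) (lam : 'I_n -> R[i]) s :
  X \in unitmx -> toC A *m X = X *m diag_mx (\row_i lam i) ->
  (forall i, s != lam i) ->
  transfer A B C D s = modal_model lam (residue B C X) (const_mx 1) D s.
Proof.
move=> Xu AX sl; rewrite /transfer /modal_model addrC; congr (_ + _).
rewrite (resolvent_diag Xu AX sl) diag_mx_sum_delta !mulmxA.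
rewrite mulmx_sumr !mulmx_suml; apply: eq_bigr => i _.
rewrite !mxE /residue -!scalemxAr -!scalemxAl -(mul_delta_mx (0 : 'I_1) i i).
by rewrite !mulmxA div1r.
Qed.

Lemma modal_modelB (lam : 'I_n -> R[i]) (Phi : 'I_n -> 'M[R[i]]_(ny, nu))
    (a b : 'cV[R]_n) (D E : 'M[R]_(ny, nu)) s :
  modal_model lam Phi a D s - modal_model lam Phi b E s =
  modal_model lam Phi (a - b) (D - E) s.
Proof.
rewrite /modal_model opprD addrACA -sumrB; congr (_ + _).
  by apply/matrixP => i j; rewrite !mxE rmorphB.
by apply: eq_bigr => i _; rewrite -scalerBl -mulrBl !mxE rmorphB.
Qed.

Lemma frobenius_norm_sqr (M : 'M[R[i]]_(ny, nu)) :
  (frobenius_norm M ^+ 2)%:C = \tr (M *m M^t*).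
Proof.
rewrite /frobenius_norm sqr_sqrtr; last first.
  by apply: sumr_ge0 => i _; apply: sumr_ge0 => j _; rewrite sqr_ge0.
rewrite /mxtrace rmorph_sum; apply: eq_bigr => i _.
rewrite !mxE rmorph_sum; apply: eq_bigr => j _.
by rewrite !mxE rmorphXn; exact: sqr_normc.
Qed.

End ModalForm.

(** * The squared H2 norm as a quadratic form *)

Section Gramian.
Local Open Scope sesquilinear_scope.
Local Open Scope complex_scope.
Local Open Scope ring_scope.
Variables (R : realType) (n nu ny : nat).
Variables (lam : 'I_n -> R[i]) (Phi : 'I_n -> 'M[R[i]]_(ny, nu)).
Hypothesis lam_lt0 : forall i, complex.Re (lam i) < 0.
Implicit Types b : 'cV[R]_n.

Let Q := Qmx lam Phi.

(** A plain transpose suffices because [b] is real; at [b = const_mx 1 - a] this unfolds to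
    [truncation_objective]. *)
Definition real_form (P : 'M[R[i]]_n) b : R[i] := ((toC b)^T *m P *m toC b) 0 0.

Lemma real_formE (P : 'M[R[i]]_n) b :
  real_form P b = \sum_i \sum_j (b i 0)%:C * (b j 0)%:C * P i j.
Proof.
rewrite /real_form mxE exchange_big/=; apply: eq_bigr => i _.
rewrite mxE mulr_suml; apply: eq_bigr => j _.
by rewrite !mxE; ring.
Qed.

Lemma mxtrace_mul_conjtr (M N : 'M[R[i]]_(ny, nu)) :
  \tr (M *m N^t*) = (\tr (N *m M^t*))^*.
Proof.
rewrite rmorph_sum; apply: eq_bigr => i _.
rewrite !mxE rmorph_sum; apply: eq_bigr => j _.
by rewrite !mxE rmorphM /= conjCK mulrC.
Qed.

Lemma Qmx_conj i j : Q i j = (Q j i)^*.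
Proof.
rewrite !mxE mxtrace_mul_conjtr fmorph_div; congr (_ / _).
by rewrite rmorphB rmorphN /= conjCK addrC.
Qed.

Lemma Qmx_herm : Q \is hermsymmx.
Proof.
apply/is_hermitianmxP; rewrite expr0 scale1r.
by apply/matrixP => i j; rewrite [LHS]Qmx_conj !mxE.
Qed.

(** Conjugation swaps the indices of [Q], and exchanging the sums undoes this. It makes the
    objective real and also cancels the logarithms in the integral. *)
Lemma herm_real_form_Im b : complex.Im (real_form Q b) = 0.
Proof.
suff /CrealP : (real_form Q b)^* = real_form Q b.
  by move=> /complex_realP[k ->].
rewrite real_formE rmorph_sum exchange_big/=; apply: eq_bigr => i _.
rewrite rmorph_sum; apply: eq_bigr => j _.
rewrite [in RHS]Qmx_conj !rmorphM /=; congr (_ * _).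
by rewrite mulrC; congr (_ * _); exact: conjc_real.
Qed.

Lemma mxtrace_sum_conjtr (x : 'I_n -> R[i]) :
  \tr ((\sum_i x i *: Phi i) *m (\sum_i x i *: Phi i)^t*) =
  \sum_i \sum_j x i * (x j)^* * \tr (Phi i *m (Phi j)^t*).
Proof.
rewrite mulmx_suml raddf_sum; apply: eq_bigr => i _.
rewrite linear_sum map_mx_sum mulmx_sumr raddf_sum; apply: eq_bigr => j _.
by rewrite linearZ /= map_mxZ -scalemxAl -scalemxAr scalerA mxtraceZ.
Qed.

Lemma imag_axis_neq w i : 0 +i* w != lam i.
Proof. by apply: contraTneq (lam_lt0 i) => <- /=; rewrite ltxx. Qed.

(** The numerator attached to the pole [lam i] once the energy is split into partial fractions. *)
Definition row_form b i : R[i] := \sum_j (b i 0)%:C * (b j 0)%:C * Q i j.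

Lemma pole_sum_neq0 i j : - lam i - (lam j)^* != 0.
Proof.
apply: contraTneq (ltrD (lam_lt0 i) (lam_lt0 j)) => /(congr1 (@complex.Re R)).
have -> : complex.Re (- lam i - (lam j)^*) =
    - complex.Re (lam i) - complex.Re (lam j).
  by case: (lam i) (lam j) => [? ?] [? ?].
by move=> E; rewrite addr0 -oppr_gt0 opprD E /= ltxx.
Qed.

(** On the imaginary axis [z^* = - z], so the two denominators [z - lam i] and [(z - lam j)^*] add
    up to a constant independent of [w]. *)
Lemma partial_fraction w i j (z := 0 +i* w) :
  (z - lam i)^-1 * ((z - lam j)^-1)^* * (- lam i - (lam j)^*) =
  (z - lam i)^-1 + ((z - lam j)^-1)^*.
Proof.
have zi : z - lam i != 0 by rewrite subr_eq0 imag_axis_neq.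
have zj : (z - lam j)^* != 0 by rewrite conjC_eq0 subr_eq0 imag_axis_neq.
have -> : - lam i - (lam j)^* = (z - lam i) + (z - lam j)^*.
  rewrite rmorphB /=; have -> : z^* = - z; last by ring.
  by apply/eqP; rewrite eq_complex /= oppr0 !eqxx.
rewrite fmorphV /=.
move: (z - lam i) ((z - lam j)^*) zi zj => p q p0 q0; field.
exact/andP.
Qed.

Lemma Re_mul_inv_imag_axis (c l : R[i]) w :
  complex.Re (c / (0 +i* w - l)) =
  (complex.Re c * - complex.Re l + complex.Im c * (w - complex.Im l)) /
  ((- complex.Re l) ^+ 2 + (w - complex.Im l) ^+ 2).
Proof.
by case: c l => [c1 c2] [l1 l2] /=; rewrite sub0r; ring.
Qed.

(** Partial fractions split the double sum of the trace into a part indexed by the poles and its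
    conjugate, which gives twice a real part. The right-hand side has the shape integrated by
    [integral_partial_fractions]. *)
Lemma modal_energy b w :
  frobenius_norm (modal_model lam Phi b 0 (0 +i* w)) ^+ 2 =
  \sum_i (2 * complex.Re (row_form b i) * - complex.Re (lam i) +
          2 * complex.Im (row_form b i) * (w - complex.Im (lam i))) /
         ((- complex.Re (lam i)) ^+ 2 + (w - complex.Im (lam i)) ^+ 2).
Proof.
apply: (@complexI R).
set z := 0 +i* w.
rewrite frobenius_norm_sqr /modal_model map_mx0 add0r mxtrace_sum_conjtr.
transitivity (\sum_i (row_form b i / (z - lam i) +
                      (row_form b i / (z - lam i))^*)).
  transitivity (\sum_i \sum_j (b i 0)%:C * (b j 0)%:C * Q i j *
      ((z - lam i)^-1 + ((z - lam j)^-1)^*)).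
    apply: eq_bigr => i _; apply: eq_bigr => j _.
    rewrite -partial_fraction mxE rmorphM /=.
    have -> : ((b j 0)%:C)^* = (b j 0)%:C by exact: conjc_real.
    have := pole_sum_neq0 i j; rewrite -/z.
    move: (_^*) (\tr _) (_^-1^*) (_^-1) => ? ? ? ? d0; by field.
  transitivity (\sum_i (row_form b i / (z - lam i) +
      \sum_j (b i 0)%:C * (b j 0)%:C * Q i j * ((z - lam j)^-1)^*)).
    apply: eq_bigr => i _; rewrite /row_form mulr_suml -big_split/=.
    by apply: eq_bigr => j _; rewrite mulrDr.
  rewrite big_split [RHS]big_split /=; congr (_ + _).
  (* After the indices are exchanged, [Q i j = (Q j i)^*] identifies the second half with the
     conjugate of the first. *)
  rewrite exchange_big/=; apply: eq_bigr => i _.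
  rewrite -mulr_suml rmorphM /=; congr (_ * _).
  rewrite /row_form rmorph_sum; apply: eq_bigr => j _.
  rewrite [in LHS]Qmx_conj !rmorphM /=; congr (_ * _).
  by rewrite mulrC; congr (_ * _); symmetry; exact: conjc_real.
rewrite rmorph_sum; apply: eq_bigr => i _.
rewrite [LHS](addcJ (row_form b i / (z - lam i))) Re_mul_inv_imag_axis.
rewrite -(rmorph_nat (real_complex R)) -rmorphM; congr (_%:C).
by ring.
Qed.

Lemma sum_row_form b : \sum_i row_form b i = real_form Q b.
Proof. by rewrite real_formE. Qed.

Lemma integral_modal_energy b :
  (\int[lebesgue_measure]_w
     (frobenius_norm (modal_model lam Phi b 0 (0 +i* w)) ^+ 2)%:E =
   (2 * pi * complex.Re (real_form Q b))%:E)%E.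
Proof.
have ReE : complex.Re (real_form Q b) = \sum_i complex.Re (row_form b i).
  rewrite -sum_row_form; exact: (raddf_sum (@complex.Re R : Rcomplex R -> R)).
have ImE : \sum_i complex.Im (row_form b i) = 0.
  rewrite -[RHS](herm_real_form_Im b) -sum_row_form; symmetry.
  exact: (raddf_sum (@complex.Im R : Rcomplex R -> R)).
under eq_integral do rewrite modal_energy.
rewrite integral_partial_fractions.
- by rewrite -mulr_sumr ReE; congr EFin; ring.
- by move=> i; rewrite oppr_gt0.
- by rewrite -mulr_sumr ImE mulr0.
- by move=> w; rewrite -modal_energy sqr_ge0.
Qed.

(** Up to the factor [2 * pi] this is the integral of a squared norm. It is the semidefiniteness
    behind convexity, and it allows square roots to be compared through their arguments. *)
Lemma real_form_ge0 b : 0 <= complex.Re (real_form Q b).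
Proof.
have : (0 <= (2 * pi * complex.Re (real_form Q b))%:E)%E.
  rewrite -integral_modal_energy; apply: integral_ge0 => w _.
  by rewrite lee_fin sqr_ge0.
by rewrite lee_fin pmulr_rge0// mulr_gt0// pi_gt0.
Qed.

(** Agreement is required only off the poles, where [transfer] is meaningful; the integral runs over
    the imaginary axis, which stability keeps free of poles. *)
Lemma h2_norm_modal (G : R[i] -> 'M[R[i]]_(ny, nu)) b :
  (forall s, (forall i, s != lam i) -> G s = modal_model lam Phi b 0 s) ->
  strictly_proper G ->
  h2_norm G = sqrte (complex.Re (real_form Q b))%:E.
Proof.
move=> GE Gsp; rewrite /h2_norm asboolT//; congr sqrte.
under eq_integral => w _ do rewrite (GE _ (imag_axis_neq w)).
rewrite integral_modal_energy -EFinM; congr EFin; rewrite mulKf//.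
by rewrite mulf_neq0// lt0r_neq0// pi_gt0.
Qed.

End Gramian.

(** * Strict properness and the feedthrough term *)

Section StrictlyProper.

(** Clearing denominators gives [p * q0 = (c *: q0 + p0) * q]. For [c] nonzero the factor
    [c *: q0 + p0] has the size of [q0], which contradicts the bound on [p]. *)
Lemma proper_fraction_cst_eq0 (F : closedFieldType) (p q p0 q0 : {poly F}) c :
  (size p < size q)%N -> (size p0 < size q0)%N ->
  (forall s, q.[s] != 0 -> q0.[s] != 0 ->
    p.[s] / q.[s] = c + p0.[s] / q0.[s]) ->
  c = 0.
Proof.
move=> pq pq0 E; apply/eqP/negPn/negP => c0.
have q_neq0 : q != 0 by rewrite -size_poly_gt0 (leq_ltn_trans _ pq).
have q0_neq0 : q0 != 0 by rewrite -size_poly_gt0 (leq_ltn_trans _ pq0).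
(* The extra factor [q * q0] makes any nonroot avoid the zeros of both denominators, where the
   pointwise identity is available. *)
have : (p * q0 - (c *: q0 + p0) * q) * (q * q0) == 0.
  apply/negPn/negP => /closed_nonrootP[s].
  rewrite rootE !(hornerM, mulf_eq0, negb_or) => /and3P[/negP H qs q0s].
  apply: H; apply/eqP; rewrite !(hornerD, hornerN, hornerM, hornerZ).
  have := E s qs q0s.
  move: p.[s] q.[s] p0.[s] q0.[s] qs q0s => x y x0 y0 y_neq0 y0_neq0 H.
  by rewrite -[x](divfK y_neq0) H; field.
rewrite !mulf_eq0 (negPf q_neq0) (negPf q0_neq0) !orbF subr_eq0 => /eqP H.
have sz : size (c *: q0 + p0) = size q0.
  by rewrite size_polyDl size_scale.
have p_neq0 : p != 0.
  apply: contra_eq_neq H => ->; rewrite mul0r eq_sym mulf_neq0//.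
  by rewrite -size_poly_gt0 sz size_poly_gt0.
have := congr1 (fun x : {poly F} => size x) H.
rewrite /= !size_mul// ?sz; last by rewrite -size_poly_gt0 sz size_poly_gt0.
by move: (size p) (size q) (size q0) (size p0) pq pq0 => i j k l; lia.
Qed.

Variables (R : realType) (n nu ny : nat).
Variables (lam : 'I_n -> R[i]) (Phi : 'I_n -> 'M[R[i]]_(ny, nu)).

(** The common denominator is the product over all indices, repeated poles included; each numerator
    omits one factor and so has smaller size. *)
Lemma modal_fraction (c : 'I_n -> R[i]) : exists p q : {poly R[i]},
  [/\ (size p < size q)%N, forall s, q.[s] != 0 -> forall i, s != lam i
    & forall s, (forall i, s != lam i) ->
        \sum_i c i / (s - lam i) = p.[s] / q.[s]].
Proof.
pose P i := \prod_(j | j != i) ('X - (lam j)%:P).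
pose q := \prod_i ('X - (lam i)%:P).
have qE i : q = ('X - (lam i)%:P) * P i by rewrite /q (bigD1 i).
have qs s : (forall i, s != lam i) -> q.[s] != 0.
  move=> sl; rewrite horner_prod; apply/prodf_neq0 => i _.
  by rewrite hornerXsubC subr_eq0.
exists (\sum_i c i *: P i), q; split => //.
- have sq : (0 < size q)%N.
    by rewrite size_poly_gt0; apply: monic_neq0; exact: monic_prod_XsubC.
  apply: (@big_ind _ (fun p : {poly R[i]} => (size p < size q)%N)) => //.
  + by rewrite size_poly0.
  + move=> p1 p2 h1 h2; rewrite (leq_ltn_trans (size_polyD _ _))//.
    by rewrite gtn_max h1.
  + move=> i _; apply: (leq_ltn_trans (size_scale_leq _ _)).
    have Pm : P i \is monic by apply: monic_prod => j _; exact: monicXsubC.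
    by rewrite (qE i) size_monicM ?monicXsubC ?monic_neq0// size_XsubC.
- move=> s qs0 i; apply: contraNneq qs0 => ->.
  by rewrite (qE i) hornerM hornerXsubC subrr mul0r.
- move=> s sl; rewrite horner_sum mulr_suml; apply: eq_bigr => i _.
  have := qs s sl; rewrite (qE i) hornerM hornerXsubC mulf_eq0 negb_or.
  move=> /andP[_ h].
  by rewrite hornerZ -mulf_div divff ?mulr1.
Qed.

(** The sum over the poles is always strictly proper, so the constant [E] is the only
    obstruction. *)
Lemma strictly_proper_modal (G : R[i] -> 'M[R[i]]_(ny, nu)) b
    (E : 'M[R]_(ny, nu)) :
  (forall s, (forall i, s != lam i) -> G s = modal_model lam Phi b E s) ->
  strictly_proper G <-> E = 0.
Proof.
move=> GE.
have GE' k l s : (forall i, s != lam i) ->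
    G s k l = (E k l)%:C + \sum_i (b i 0)%:C * Phi i k l / (s - lam i).
  move=> sl; rewrite GE// /modal_model !mxE; congr (_ + _).
  by rewrite summxE; apply: eq_bigr => i _; rewrite mxE mulrAC.
split => [Gsp|E0 k l].
  apply/matrixP => k l; rewrite mxE; apply: (@complexI R).
  have [p [q [pq H]]] := Gsp k l.
  have [p0 [q0 [pq0 q0s H0]]] :=
    modal_fraction (fun i => (b i 0)%:C * Phi i k l).
  apply: (proper_fraction_cst_eq0 pq pq0) => s qs q0s'.
  by rewrite -H// GE' ?H0//; exact: q0s.
have [p [q [pq qs H]]] := modal_fraction (fun i => (b i 0)%:C * Phi i k l).
exists p, q; split => // s /qs sl.
by rewrite GE'// E0 mxE add0r H.
Qed.

End StrictlyProper.

(** * Real quadratic forms and their convexity *)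

Section QuadraticForm.
Variables (R : realType) (n : nat).
Implicit Types (P : 'M[R]_n) (u v : 'cV[R]_n).

Lemma quadratic_formE P u :
  (u^T *m P *m u) 0 0 = \sum_i \sum_j u i 0 * u j 0 * P i j.
Proof.
rewrite mxE exchange_big/=; apply: eq_bigr => i _.
rewrite mxE mulr_suml; apply: eq_bigr => j _.
by rewrite !mxE; ring.
Qed.

(** The convexity gap equals [t * (1 - t)] times the form at [u - v]. *)
Lemma quadratic_form_convex P u v (t : R) :
  (forall w : 'cV[R]_n, 0 <= (w^T *m P *m w) 0 0) -> 0 <= t <= 1 ->
  let w := t *: u + (1 - t) *: v in
  (w^T *m P *m w) 0 0 <=
    t * (u^T *m P *m u) 0 0 + (1 - t) * (v^T *m P *m v) 0 0.
Proof.
move=> P0 /andP[t0 t1] /=; set w := t *: u + _; rewrite -subr_ge0.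
suff -> : t * (u^T *m P *m u) 0 0 + (1 - t) * (v^T *m P *m v) 0 0 -
    (w^T *m P *m w) 0 0 = t * (1 - t) * ((u - v)^T *m P *m (u - v)) 0 0.
  by rewrite mulr_ge0// mulr_ge0// subr_ge0.
rewrite !quadratic_formE !mulr_sumr -sumrN -!big_split/=.
apply: eq_bigr => i _; rewrite !mulr_sumr -sumrN -!big_split/=.
by apply: eq_bigr => j _; rewrite !mxE; ring.
Qed.

(** The two cross terms combine because a scalar equals its transpose; this exhibits the linear and
    constant parts of the objective. *)
Lemma quadratic_form_onem P (a : 'cV[R]_n) (o := const_mx 1 : 'cV[R]_n) :
  ((o - a)^T *m P *m (o - a)) 0 0 =
  (a^T *m P *m a + (- ((P + P^T) *m o))^T *m a) 0 0 + (o^T *m P *m o) 0 0.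
Proof.
have aPo : (a^T *m P *m o) 0 0 = (o^T *m P^T *m a) 0 0.
  have -> : o^T *m P^T *m a = (a^T *m P *m o)^T.
    by rewrite !trmx_mul trmxK mulmxA.
  by rewrite [RHS]mxE.
have -> : (- ((P + P^T) *m o))^T = - (o^T *m P^T + o^T *m P).
  by rewrite linearN/= trmx_mul linearD/= trmxK mulmxDr.
have -> : (o - a)^T = o^T - a^T by rewrite linearB.
rewrite !(mulmxBl, mulmxBr, mulmxDl, mulNmx).
move: (a^T *m P *m a) (a^T *m P *m o) (o^T *m P^T *m a) aPo => x y z yz.
move: (o^T *m P *m a) (o^T *m P *m o) => p q.
by rewrite !mxE yz; ring.
Qed.

(** The weights are real, so only the real parts of the entries of [Q] contribute. *)
Lemma real_form_quadratic (Q : 'M[R[i]]_n) (b : 'cV[R]_n) :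
  complex.Re (real_form Q b) = (b^T *m map_mx (@complex.Re R) Q *m b) 0 0.
Proof.
rewrite real_formE quadratic_formE.
rewrite (raddf_sum (@complex.Re R : Rcomplex R -> R)); apply: eq_bigr => i _.
rewrite (raddf_sum (@complex.Re R : Rcomplex R -> R)); apply: eq_bigr => j _.
by rewrite !mxE; case: (Q i j) => x y /=; ring.
Qed.

End QuadraticForm.

(** * Reduction of modal truncation to a binary quadratic problem *)

Theorem theorem1 (R : realType) (n nu ny r : nat)
    (A : 'M[R]_n) (B : 'M[R]_(n, nu)) (C : 'M[R]_(ny, n)) (D : 'M[R]_(ny, nu))
    (X : 'M[R[i]]_n) (lam : 'I_n -> R[i]) (IC : {set 'I_n * 'I_n}) :
  stable A ->
  X \in unitmx ->
  toC A *m X = X *m diag_mx (\row_i lam i) ->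
  conjugate_pairing lam (residue B C X) IC ->
  (0 < r < n)%N ->
  let H := transfer A B C D in
  let Phi := residue B C X in
  let Q := Qmx lam Phi in
  let feasible := truncation_feasible r (pairing_mx R IC) in
  (forall (a : 'cV[R]_n) (Da : 'M[R]_(ny, nu)),
     minimizer [set x : 'cV[R]_n * 'M[R]_(ny, nu) | feasible x.1]
       (fun x => h2_norm (fun s => H s - modal_model lam Phi x.1 x.2 s))
       (a, Da) ->
     Da = D /\ minimizer feasible (truncation_objective Q) a) /\
  Q \is hermsymmx /\
  convex_quadratic_binary feasible (truncation_objective Q).
Proof.
move=> stA Xu AX _ _ H Phi Q feasible.
have lam_lt0 i : complex.Re (lam i) < 0.
  by apply: stA; exact: (diagonalization_eigenvalue Xu AX).
have errE a Da s : (forall i, s != lam i) ->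
    H s - modal_model lam Phi a Da s =
    modal_model lam Phi (const_mx 1 - a) (D - Da) s.
  by move=> sl; rewrite /H (transfer_modal B C D Xu AX sl) modal_modelB.
have h2E a : h2_norm (fun s => H s - modal_model lam Phi a D s) =
    sqrte (complex.Re (truncation_objective Q a))%:E.
  have errDE s : (forall i, s != lam i) -> H s - modal_model lam Phi a D s =
      modal_model lam Phi (const_mx 1 - a) 0 s.
    by move=> sl; rewrite errE// subrr.
  rewrite (h2_norm_modal lam_lt0 errDE)//.
  by apply/(strictly_proper_modal errDE).
(* This reduces comparisons in the partial order of [R[i]] to comparisons of real parts. *)
have objR a : truncation_objective Q a =
    (complex.Re (truncation_objective Q a))%:C.
  have : complex.Im (truncation_objective Q a) = 0 by exact: herm_real_form_Im.
  by case: truncation_objective => x y /= ->.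
split; [|split].
- move=> a Da [/= fa amin].
  have {Da amin} [-> amin] : Da = D /\ forall y : 'cV[R]_n * 'M[R]_(ny, nu),
      feasible y.1 ->
      (h2_norm (fun s => H s - modal_model lam Phi a D s)%R <=
       h2_norm (fun s => H s - modal_model lam Phi y.1 y.2 s)%R)%E.
    suff DaD : Da = D by split; [exact: DaD | rewrite DaD in amin; exact: amin].
    apply/esym/subr0_eq/(strictly_proper_modal (errE a Da)).
    (* Otherwise the error at [(a, Da)] has norm [+oo], while the feasible point [(a, D)] has finite
       norm. *)
    apply: contrapT => nsp; have := amin (a, D) fa; rewrite /= h2E.
    by rewrite /h2_norm asboolF//= leye_eq.
  split=> //; split=> // y fy.
  have := amin (y, D) fy; rewrite /= !h2E lee_sqrt; last first.
    by rewrite lee_fin; exact: real_form_ge0.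
  by rewrite lee_fin (objR a) (objR y) lecR.
- exact: Qmx_herm.
- split.
  (* The cardinality row is stacked on the pairing rows; the block of inequalities has no rows. *)
  + exists (1 + #|IC|)%N, 0%N, (col_mx (const_mx 1)^T (pairing_mx R IC)).
    exists (col_mx (r%:R)%:M 0), 0, 0.
    apply/seteqP; split => a.
      by move=> [ba sa ma]; split => //; [rewrite mul_col_mx sa ma | case].
    by move=> [ba]; rewrite mul_col_mx => /eq_col_mx[sa ma] _; split.
  + pose P := map_mx (@complex.Re R) Q.
    exists P, (- ((P + P^T) *m const_mx 1)).
    exists (((const_mx 1)^T *m P *m const_mx 1 : 'M[R]_1) 0 0) => a.
    by rewrite objR [complex.Re _]real_form_quadratic quadratic_form_onem.
  + move=> t x y _ _; pose P := map_mx (@complex.Re R) Q.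
    have ReE z : complex.Re (truncation_objective Q z) =
        ((const_mx 1 - z)^T *m P *m (const_mx 1 - z)) 0 0.
      exact: real_form_quadratic.
    have P_ge0 (z : 'cV[R]_n) : 0 <= (z^T *m P *m z) 0 0.
      by rewrite -real_form_quadratic; exact: real_form_ge0.
    have t01 : 0 <= t%:num <= 1 by apply/andP; split; [exact: ge0 | exact: le1].
    (* The affine map [a -> 1 - a] preserves convex combinations, so convexity passes from the form
       to the objective. *)
    have convE : const_mx 1 - (t%:num *: (x : 'cV[R]_n) +
          (1 - t%:num) *: (y : 'cV[R]_n)) =
        t%:num *: (const_mx 1 - x) + (1 - t%:num) *: (const_mx 1 - y).
      by apply/matrixP => i j; rewrite !mxE; ring.
    have := quadratic_form_convex (const_mx 1 - x) (const_mx 1 - y) P_ge0 t01.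
    by rewrite /= -convE -!ReE.
Qed.
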